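(* Every CCLT group is metacyclic and hence supersolvable.
   Context: All groups are finite. A finite group $G$ is a CCLT (Cyclic CLT) group if for every proper divisor $d$ of $|G|$ (positive divisor $d\neq |G|$), $G$ contains a cyclic subgroup of order $d$. A group $G$ is metacyclic if it contains a cyclic normal subgroup $H$ such that $G/H$ is cyclic. *)

(* Defs.v *)
From mathcomp Require Import all_boot all_fingroup all_solvable.

Set Implicit Arguments.
Unset Strict Implicit.
Unset Printing Implicit Defensive.

Local Open Scope group_scope.

Definition CCLT (gT : finGroupType) (G : {group gT}) : Prop :=
  forall d : nat, d %| #|G| -> d != #|G| ->
    exists H : {group gT}, [/\ H \subset G, cyclic H & #|H| = d].

(* A single step H <= K of a normal series of G: both terms are normal in the
   whole group G, not just in the next term. *)
Definition supersolvable_factor (gT : finGroupType) (G H K : {group gT}) :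
    bool :=
  [&& H <| G, K <| G, H \subset K & cyclic (K / H)].

Definition supersolvable (gT : finGroupType) (G : {group gT}) : Prop :=
  exists2 s : seq {group gT},
    path (supersolvable_factor G) 1%G s & last 1%G s = G.

(* Main.v *)
Require Import Defs.
From mathcomp Require Import all_boot all_fingroup all_solvable.

Local Open Scope group_scope.

(** Let [p] be the smallest prime divisor of [#|G|]. A nontrivial CCLT group
    has a cyclic subgroup [H] of order [#|G| / p], that is, of index [p]. A
    subgroup whose index is the smallest prime divisor of the order is normal
    ([normal_index_pdiv]), and [G / H] has prime order, hence is cyclic. So
    [G] is metacyclic, and [1 <= H <= G] is then a normal series with cyclic
    factors. *)

(** A product of [H] with a conjugate [H :^ x] covers [G] only if [x \in H],
    since [x = h * h' ^ x] forces [x = h' * h]. So if [x \notin H] then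
    [#|H| * #|H : H :&: H :^ x| = #|H * H :^ x| < #|G| = #|H| * pdiv #|G|].
    The index [#|H : H :&: H :^ x|] is thus a divisor of [#|G|] smaller than
    [pdiv #|G|]: it is [1], whence [H = H :^ x]. *)
Lemma normal_index_pdiv (gT : finGroupType) (G H : {group gT}) :
  H \subset G -> #|G : H| = pdiv #|G| -> H <| G.
Proof.
move=> sHG iHG; rewrite /normal sHG; apply/subsetP=> x Gx.
have [Hx | notHx] := boolP (x \in H); first exact: subsetP (normG H) x Hx.
have notHHx : x \notin H * H :^ x.
  apply: contra notHx => /mulsgP[h _ Hh /imsetP[h' Hh' ->]] Dx.
  have Dh' : h * x^-1 * h' = 1.
    by apply: (mulIg x); rewrite mul1g [RHS]Dx conjgE !mulgA.
  move/eqP: Dh'; rewrite mulg_eq1 => /eqP Dh'.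
  by rewrite -groupV -(groupMl _ Hh) Dh' groupV.
have ltHG : #|H * H :^ x| < #|G|.
  apply/proper_card/properP; split; last by exists x.
  by rewrite mul_subG // conj_subG.
have iK1 : #|H : H :^ x| == 1%N.
  have ltip : #|H : H :^ x| < pdiv #|G|.
    rewrite -iHG -(ltn_pmul2l (cardG_gt0 H)) Lagrange //.
    rewrite -(ltn_pmul2r (cardG_gt0 (H :&: H :^ x))) -indexgI -mulnA.
    rewrite (mulnC #|_ : _|) Lagrange ?subsetIl //.
    rewrite -{2}(cardJg H x) (mul_cardG H).
    by rewrite ltn_pmul2r ?cardG_gt0.
  have idv : #|H : H :^ x| %| #|G|.
    exact: dvdn_trans (dvdn_indexg _ _) (cardSg sHG).
  apply: contraLR ltip; rewrite -leqNgt => neq1.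
  by apply: pdiv_min_dvd; rewrite // ltn_neqAle eq_sym neq1 indexg_gt0.
by rewrite -groupV inE sub_conjgV -indexg_eq1.
Qed.

Lemma CCLT_metacyclic (gT : finGroupType) (G : {group gT}) :
  CCLT G -> metacyclic G.
Proof.
move=> cG; have [G1 | gt1G] := leqP #|G| 1.
  by apply: cyclic_metacyclic; rewrite (card_le1_trivg G1) cyclic1.
have [p_pr p_dv] := (pdiv_prime gt1G, pdiv_dvd #|G|).
have [|| H [sHG cycH oH]] := cG (#|G| %/ pdiv #|G|).
- exact: dvdn_div.
- by rewrite ltn_eqF // ltn_Pdiv ?prime_gt1.
have iHG : #|G : H| = pdiv #|G| by rewrite -divgS // oH divnA // mulKn.
have nsHG := normal_index_pdiv _ _ _ sHG iHG.
apply/metacyclicP; exists H; split=> //.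
by apply: prime_cyclic; rewrite card_quotient ?normal_norm // iHG.
Qed.

Lemma metacyclic_supersolvable (gT : finGroupType) (G : {group gT}) :
  metacyclic G -> supersolvable G.
Proof.
case/metacyclicP=> H [cycH nsHG cycGH].
exists [:: H; G] => //=; rewrite /supersolvable_factor.
rewrite normal1 nsHG normal_refl sub1G normal_sub //=.
by rewrite cycGH quotient_cyclic.
Qed.

Theorem proposition3p4 (gT : finGroupType) (G : {group gT}) :
  CCLT G -> metacyclic G /\ supersolvable G.
Proof.
move=> /CCLT_metacyclic mG; split=> //.
exact: metacyclic_supersolvable.
Qed.
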